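(* Let $X$, $Y$ be Banach spaces and let $G\in L(X,Y)$ be a norm-one operator. If $G$ has the alternative Daugavet property, then its linearization $\widehat{G}:\mathcal{F}(X)\to Y$ to the Lipschitz-free space has the alternative Daugavet property.
   Context: Scalars are $\mathbb{K}=\mathbb{R}$ or $\mathbb{C}$; $\mathbb{T}=\{\omega\in\mathbb{K}:|\omega|=1\}$. $G\in L(X,Y)$ has the alternative Daugavet property if $\sup_{\omega\in\mathbb{T}}\|G+\omega T\|=1+\|T\|$ for every rank-one $T\in L(X,Y)$. $\operatorname{Lip}_0(X,Y)$ is the Banach space of all Lipschitz maps $F:X\to Y$ with $F(0)=0$, with norm $\|F\|_L=\sup\{\|F(x)-F(y)\|/\|x-y\|:x\neq y\}$. For $x\in X$ let $\delta_x\in\operatorname{Lip}_0(X,\mathbb{K})^*$ be the evaluation $\delta_x(f)=f(x)$. The Lipschitz-free space over $X$ is $\mathcal{F}(X)=\overline{\operatorname{span}}\{\delta_x:x\in X\}\subset\operatorname{Lip}_0(X,\mathbb{K})^*$ (norm closure, $\mathbb{K}$-linear span). For $F\in\operatorname{Lip}_0(X,Y)$, $\widehat{F}:\mathcal{F}(X)\to Y$ is the unique bounded linear operator with $\widehat{F}(\delta_x)=F(x)$ for all $x\in X$; the map $F\mapsto\widehat{F}$ is an isometric isomorphism from $\operatorname{Lip}_0(X,Y)$ onto $L(\mathcal{F}(X),Y)$. A bounded linear $G:X\to Y$ is regarded as an element of $\operatorname{Lip}_0(X,Y)$. *)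

(* Defs.v *)
From HB Require Import structures.
From mathcomp Require Import all_boot all_order all_algebra.
From mathcomp Require Import all_classical all_reals all_analysis.
From mathcomp Require Import complex.

Set Implicit Arguments.
Unset Strict Implicit.
Unset Printing Implicit Defensive.

Import Order.TTheory GRing.Theory Num.Theory.
Import numFieldNormedType.Exports.

Local Open Scope classical_set_scope.
Local Open Scope ring_scope.

Inductive scalar_kind := RealScalars | ComplexScalars.

Definition scalars (R : realType) (k : scalar_kind) : numFieldType :=
  match k with
  | RealScalars => R : numFieldType
  | ComplexScalars => R[i] : numFieldType
  end.

(* Norms take their values in the scalar field, where [R[i]] carries the partial
   order "[y - x] is real and nonnegative". A nonempty bounded set of
   nonnegative scalars has a least upper bound for this order. *)
Definition ksup {K : numFieldType} (A : set K) : K := supremum 0 A.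

Lemma ksup0 (K : numFieldType) : ksup (@set0 K) = 0.
Proof. exact: supremum0. Qed.

Lemma real_supremums (R : realType) (A : set R) (M : R) :
  A !=set0 -> ubound A M -> supremums A !=set0.
Proof.
move=> A0 AM; have hA : has_ubound A by exists M.
by exists (sup A); split; [exact: ub_le_sup | move=> b; exact: ge_sup].
Qed.

Lemma complex_supremums (R : realType) (A : set R[i]) (M : R[i]) :
  A !=set0 -> (forall a, A a -> 0 <= a) -> ubound A M -> supremums A !=set0.
Proof.
move=> A0 Age AM; pose B : set R := [set x | A x%:C%C].
have AB a : A a -> exists2 x, B x & a = x%:C%C.
  case: a => x y Aa; have := Age _ Aa.
  by rewrite lecE /= => /andP[/eqP y0 _]; exists x => //; subst y.
have B0 : B !=set0 by have [a /AB[x Bx _]] := A0; exists x.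
have hB : has_ubound B.
  exists (complex.Re M) => x Bx.
  by have := AM _ Bx; case: M {AM} => u v; rewrite lecE /= => /andP[].
exists (sup B)%:C%C; split.
  by move=> a /AB[x Bx ->]; rewrite lecR; exact: ub_le_sup.
move=> [u v] bA; have [x Bx] := B0.
have := bA _ Bx; rewrite !lecE /= => /andP[-> _] /=.
apply: ge_sup => // z Bz.
by have := bA _ Bz; rewrite lecE /= => /andP[].
Qed.

Lemma scalars_supremums (R : realType) (k : scalar_kind)
    (A : set (scalars R k)) (M : scalars R k) :
  A !=set0 -> (forall a, A a -> 0 <= a) -> ubound A M ->
  supremums A !=set0.
Proof.
case: k A M => A M A0 Age AM; first exact: (@real_supremums R A M A0 AM).
exact: (@complex_supremums R A M A0 Age AM).
Qed.

Section ksup_theory.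
Context {R : realType} {k : scalar_kind}.
Local Notation K := (scalars R k).
Implicit Types (A : set K) (M a : K).

Lemma ksup_ubound A M a :
  (forall x, A x -> 0 <= x) -> ubound A M -> A a -> a <= ksup A.
Proof.
move=> Age AM Aa; have A0 : A !=set0 by exists a.
have [s sA] := scalars_supremums A0 Age AM.
rewrite /ksup /supremum ifF; last by apply/negbTE/set0P.
by case: xgetP => [y _ [yA _]|/(_ s)/(_ sA)]//; exact: yA.
Qed.

Lemma ksup_le A M :
  (forall x, A x -> 0 <= x) -> 0 <= M -> ubound A M -> ksup A <= M.
Proof.
move=> Age M0 AM; have [->|/set0P A0] := eqVneq A set0; first by rewrite ksup0.
have [s sA] := scalars_supremums A0 Age AM.
rewrite /ksup /supremum ifF; last by apply/negbTE/set0P.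
by case: xgetP => [y _ [_ yA]|/(_ s)/(_ sA)]//; exact: yA.
Qed.

Lemma ksup_ge0 A M : (forall x, A x -> 0 <= x) -> ubound A M -> 0 <= ksup A.
Proof.
move=> Age AM; have [->|/set0P[a Aa]] := eqVneq A set0; first by rewrite ksup0.
exact: le_trans (Age _ Aa) (ksup_ubound Age AM Aa).
Qed.

End ksup_theory.

Section bounded_linear_operators.
Context {R : realType} {k : scalar_kind}.
Local Notation K := (scalars R k).
Variables E F : normedModType K.

Definition blin_pred : {pred E -> F} := [pred f | `[< linear f /\ continuous f >]].

Record blin := Blin { blin_fun :> E -> F; _ : blin_fun \in blin_pred }.

HB.instance Definition _ := [isSub for blin_fun].
HB.instance Definition _ := [Choice of blin by <:].

Lemma blin_submod_closed : submod_closed blin_pred.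
Proof.
split.
  apply/asboolP; split; last exact: cst_continuous.
  by move=> a x y; rewrite /= scaler0 addr0.
move=> a f g /asboolP[lf cf] /asboolP[lg cg]; apply/asboolP; split.
  move=> b x y; rewrite /= !fctE lf lg !scalerDr !scalerA mulrC -!addrA.
  by congr (_ + _); rewrite addrCA.
move=> x; apply: cvgD; last exact: cg.
by apply: cvgZl_tmp; exact: cf.
Qed.

HB.instance Definition _ := GRing.isSubmodClosed.Build _ _ blin_pred blin_submod_closed.
HB.instance Definition _ := [SubChoice_isSubLmodule of blin by <:].

Implicit Types (f g : blin).

Lemma blin_is_linear f : linear f.
Proof. by have /asboolP[] := valP f. Qed.

HB.instance Definition _ f :=
  GRing.isLinear.Build K E F *:%R f (@blin_is_linear f).

Lemma blin_continuous f : continuous f.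
Proof. by have /asboolP[] := valP f. Qed.

Lemma blin_bounded f : exists2 M : K, 0 < M & forall x, `|f x| <= M * `|x|.
Proof.
have /linear_boundedP/pinfty_ex_gt0[M M0 fM] :=
  (linear_bounded_continuous f).2 (@blin_continuous f).
by exists M.
Qed.

Lemma blin_of_subproof (f : {linear E -> F}) (M : K) :
  (forall x, `|f x| <= M * `|x|) -> (f : E -> F) \in blin_pred.
Proof.
move=> fM; apply/asboolP; split; first exact: linearP.
apply/linear_bounded_continuous/linear_boundedP.
have pf := @globally_properfilter _ [set: E] 0 I.
have /(@ex_dom_bound _ _ _ _ id f) : exists M, dominated_by id M f (globally setT).
  by exists M => x _; exact: fM.
by apply: filterS => r fr x; exact: fr.
Qed.

Definition blin_norm f : K := ksup [set `|f x| | x in [set x | `|x| <= 1]].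

Let blin_norm_nneg f r : [set `|f x| | x in [set x | `|x| <= 1]] r -> 0 <= r.
Proof. by case=> x _ <-. Qed.

Let blin_norm_bnd f : exists M, ubound [set `|f x| | x in [set x | `|x| <= 1]] M.
Proof.
have [M M0 fM] := blin_bounded f; exists M => _ [x /= x1 <-].
by rewrite (le_trans (fM x))// ler_piMr// ltW.
Qed.

Lemma blin_norm_ge0 f : 0 <= blin_norm f.
Proof.
by have [M fM] := blin_norm_bnd f; exact: ksup_ge0 (@blin_norm_nneg f) fM.
Qed.

Lemma blin_norm_ub f x : `|f x| <= blin_norm f * `|x|.
Proof.
have [->|x0] := eqVneq x 0; first by rewrite linear0 !normr0 mulr0.
have nx0 : 0 < `|x| by rewrite normr_gt0.
have [M fM] := blin_norm_bnd f.
rewrite -ler_pdivrMr// mulrC.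
have -> : `|x|^-1 * `|f x| = `|f (`|x|^-1 *: x)|.
  by rewrite linearZ normrZ ger0_norm// invr_ge0.
apply: ksup_ubound (@blin_norm_nneg f) fM _; exists (`|x|^-1 *: x) => //=.
by rewrite normrZ ger0_norm ?invr_ge0// mulVf// gt_eqF.
Qed.

Lemma blin_norm_le f (M : K) :
  0 <= M -> (forall x, `|f x| <= M * `|x|) -> blin_norm f <= M.
Proof.
move=> M0 fM; apply: (ksup_le (@blin_norm_nneg f) M0) => r [x /= x1 <-].
by rewrite (le_trans (fM x))// ler_piMr.
Qed.

Lemma blin_normD f g : blin_norm (f + g) <= blin_norm f + blin_norm g.
Proof.
apply: blin_norm_le => [|x]; first by rewrite addr_ge0 ?blin_norm_ge0.
by rewrite mulrDl (le_trans (ler_normD _ _))// lerD ?blin_norm_ub.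
Qed.

Let blin_normZ_le (l : K) f : blin_norm (l *: f) <= `|l| * blin_norm f.
Proof.
apply: blin_norm_le => [|x]; first by rewrite mulr_ge0 ?blin_norm_ge0.
by rewrite [leLHS]normrZ -mulrA ler_wpM2l// blin_norm_ub.
Qed.

Lemma blin_normZ (l : K) f : blin_norm (l *: f) = `|l| * blin_norm f.
Proof.
have [->|l0] := eqVneq l 0.
  rewrite scale0r normr0 mul0r; apply/eqP; rewrite eq_le blin_norm_ge0 andbT.
  by apply: blin_norm_le => // x; rewrite normr0 mul0r.
apply/eqP; rewrite eq_le blin_normZ_le/=.
rewrite -ler_pdivlMl ?normr_gt0// -normfV.
by have := blin_normZ_le l^-1 (l *: f); rewrite scalerA mulVf// scale1r.
Qed.

Lemma blin_norm0_eq0 f : blin_norm f = 0 -> f = 0.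
Proof.
move=> f0; apply/val_inj/funext => x; apply/eqP; rewrite -normr_le0.
by rewrite (le_trans (blin_norm_ub f x))// f0 mul0r.
Qed.

HB.instance Definition _ :=
  Lmodule_isNormed.Build K blin blin_normD blin_normZ blin_norm0_eq0.

End bounded_linear_operators.

Section alternative_daugavet.
Context {R : realType} {k : scalar_kind}.
Local Notation K := (scalars R k).

Definition rank_one (E F : normedModType K) (T : blin E F) :=
  exists2 y : F, y != 0 & range T = [set a *: y | a in [set: K]].

Definition alternative_daugavet (E F : normedModType K) (G : blin E F) :=
  forall T : blin E F, rank_one T ->
    ksup [set `|G + w *: T| | w in [set w : K | `|w| = 1]] = 1 + `|T|.

End alternative_daugavet.

Section lipschitz_maps.
Context {R : realType} {k : scalar_kind}.
Local Notation K := (scalars R k).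
Variables X Y : normedModType K.

Definition lip0_pred : {pred X -> Y} :=
  [pred f | `[< f 0 = 0 /\ lipschitz f >]].

Record lip0 := Lip0 { lip0_fun :> X -> Y; _ : lip0_fun \in lip0_pred }.

HB.instance Definition _ := [isSub for lip0_fun].
HB.instance Definition _ := [Choice of lip0 by <:].

Lemma lipschitzP (f : X -> Y) :
  lipschitz f <-> exists M : K, forall x y, `|f x - f y| <= M * `|x - y|.
Proof.
split.
  move=> /(@ex_dom_bound _ _ _ _ (self_sub id) (self_sub f)).
  have := @globally_properfilter _ ([set: X] `*` [set: X]) (0, 0).
  by move=> pf /(_ (pf _))[//|M fM]; exists M => x y; exact: (fM (x, y)).
move=> [M fM]; apply: (@klipschitzW _ _ _ M).
  exact: (@globally_properfilter _ _ (0, 0)).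
by move=> [x y] _; exact: fM.
Qed.

Lemma lip0_submod_closed : submod_closed lip0_pred.
Proof.
split.
  apply/asboolP; split => //; apply/lipschitzP; exists 0 => x y.
  by rewrite subrr normr0 mul0r.
move=> a f g /asboolP[f0 /lipschitzP[M fM]] /asboolP[g0 /lipschitzP[N gN]].
apply/asboolP; split; first by rewrite !fctE f0 g0 scaler0 addr0.
apply/lipschitzP; exists (`|a| * M + N) => x y.
rewrite !fctE opprD addrACA -scalerBr mulrDl (le_trans (ler_normD _ _))//.
by rewrite lerD// normrZ -mulrA ler_wpM2l.
Qed.

HB.instance Definition _ :=
  GRing.isSubmodClosed.Build _ _ lip0_pred lip0_submod_closed.
HB.instance Definition _ := [SubChoice_isSubLmodule of lip0 by <:].

Implicit Types (f g : lip0).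

Lemma lip0_at0 f : f 0 = 0.
Proof. by have /asboolP[] := valP f. Qed.

Lemma lip0_lipschitz f : lipschitz f.
Proof. by have /asboolP[] := valP f. Qed.

Definition lip0_norm f : K :=
  ksup [set `|f p.1 - f p.2| / `|p.1 - p.2| | p in [set p | p.1 != p.2]].

Let lip0_norm_nneg f r :
  [set `|f p.1 - f p.2| / `|p.1 - p.2| | p in [set p | p.1 != p.2]] r -> 0 <= r.
Proof. by case=> p _ <-; rewrite divr_ge0. Qed.

Let lip0_norm_bnd f : exists M, ubound
  [set `|f p.1 - f p.2| / `|p.1 - p.2| | p in [set p | p.1 != p.2]] M.
Proof.
have /lipschitzP[M fM] := lip0_lipschitz f; exists M => _ [[x y] /= xy <-].
by rewrite ler_pdivrMr ?normr_gt0 ?subr_eq0.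
Qed.

Lemma lip0_norm_ge0 f : 0 <= lip0_norm f.
Proof.
by have [M fM] := lip0_norm_bnd f; exact: ksup_ge0 (@lip0_norm_nneg f) fM.
Qed.

Lemma lip0_norm_ub f x y : `|f x - f y| <= lip0_norm f * `|x - y|.
Proof.
have [->|xy] := eqVneq x y; first by rewrite !subrr !normr0 mulr0.
have [M fM] := lip0_norm_bnd f.
rewrite -ler_pdivrMr ?normr_gt0 ?subr_eq0//.
by apply: ksup_ubound (@lip0_norm_nneg f) fM _; exists (x, y).
Qed.

Lemma lip0_norm_le f (M : K) :
  0 <= M -> (forall x y, `|f x - f y| <= M * `|x - y|) -> lip0_norm f <= M.
Proof.
move=> M0 fM; apply: (ksup_le (@lip0_norm_nneg f) M0) => r [[x y] /= xy <-].
by rewrite ler_pdivrMr ?normr_gt0 ?subr_eq0.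
Qed.

Lemma lip0_normD f g : lip0_norm (f + g) <= lip0_norm f + lip0_norm g.
Proof.
apply: lip0_norm_le => [|x y]; first by rewrite addr_ge0 ?lip0_norm_ge0.
have -> : (f + g) x - (f + g) y = (f x - f y) + (g x - g y).
  by rewrite addrACA -opprD.
by rewrite mulrDl (le_trans (ler_normD _ _))// lerD ?lip0_norm_ub.
Qed.

Let lip0_normZ_le (l : K) f : lip0_norm (l *: f) <= `|l| * lip0_norm f.
Proof.
apply: lip0_norm_le => [|x y]; first by rewrite mulr_ge0 ?lip0_norm_ge0.
have -> : (l *: f) x - (l *: f) y = l *: (f x - f y) by rewrite scalerBr.
by rewrite normrZ -mulrA ler_wpM2l// lip0_norm_ub.
Qed.

Lemma lip0_normZ (l : K) f : lip0_norm (l *: f) = `|l| * lip0_norm f.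
Proof.
have [->|l0] := eqVneq l 0.
  rewrite scale0r normr0 mul0r; apply/eqP; rewrite eq_le lip0_norm_ge0 andbT.
  by apply: lip0_norm_le => // x y; rewrite subrr normr0 mul0r.
apply/eqP; rewrite eq_le lip0_normZ_le/=.
rewrite -ler_pdivlMl ?normr_gt0// -normfV.
by have := lip0_normZ_le l^-1 (l *: f); rewrite scalerA mulVf// scale1r.
Qed.

Lemma lip0_norm0_eq0 f : lip0_norm f = 0 -> f = 0.
Proof.
move=> f0; apply/val_inj/funext => x; apply/eqP; rewrite -normr_le0.
by have := lip0_norm_ub f x 0; rewrite lip0_at0 subr0 f0 mul0r.
Qed.

HB.instance Definition _ :=
  Lmodule_isNormed.Build K lip0 lip0_normD lip0_normZ lip0_norm0_eq0.

Lemma lip0_of_blin_subproof (G : blin X Y) : (G : X -> Y) \in lip0_pred.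
Proof.
apply/asboolP; split; first exact: linear0.
apply/lipschitzP; exists `|G| => x y; rewrite -linearB.
exact: blin_norm_ub.
Qed.

Definition lip0_of_blin (G : blin X Y) : lip0 := Lip0 (lip0_of_blin_subproof G).

End lipschitz_maps.

Section lipfree_space.
Context {R : realType} {k : scalar_kind}.
Local Notation K := (scalars R k).
Variable X : normedModType K.

Definition lip0_dual : normedModType K := blin (lip0 X K^o) K^o.

Lemma lip_eval_subproof (x : X) :
  (fun f : lip0 X K^o => f x) \in @blin_pred R k (lip0 X K^o) K^o.
Proof.
pose e : lip0 X K^o -> K^o := fun f => f x.
have le : linear e by [].
pose E : {linear lip0 X K^o -> K^o} :=
  HB.pack e (GRing.isLinear.Build _ _ _ _ e le).
apply: (@blin_of_subproof _ _ _ _ E `|x|) => f.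
by have := lip0_norm_ub f x 0; rewrite lip0_at0 !subr0 mulrC.
Qed.

(* [lip_eval x] is the evaluation at [x] in the dual of Lip_0(X, K); [lip_delta x] below
   is the same functional seen in the free space. *)
Definition lip_eval (x : X) : lip0_dual := Blin (lip_eval_subproof x).

Definition lip_eval_span : set lip0_dual :=
  [set mu | exists n (a : 'I_n -> K) (x : 'I_n -> X),
     mu = \sum_(i < n) a i *: lip_eval (x i)].

Definition lipfree_pred : {pred lip0_dual} := [pred mu | `[< closure lip_eval_span mu >]].

Record lipfree := Lipfree { lipfree_val : lip0_dual; _ : lipfree_val \in lipfree_pred }.

HB.instance Definition _ := [isSub for lipfree_val].
HB.instance Definition _ := [Choice of lipfree by <:].

Lemma lip_eval_span_closed (a : K) mu nu :
  lip_eval_span mu -> lip_eval_span nu -> lip_eval_span (a *: mu + nu).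
Proof.
move=> [n [b [x ->]]] [m [c [y ->]]]; exists (n + m)%N.
exists (fun i => match fintype.split i with inl j => a * b j | inr j => c j end).
exists (fun i => match fintype.split i with inl j => x j | inr j => y j end).
rewrite big_split_ord/= scaler_sumr; congr (_ + _); apply: eq_bigr => i _.
  by rewrite (unsplitK (inl i : 'I_n + 'I_m)) scalerA.
by rewrite (unsplitK (inr i : 'I_n + 'I_m)).
Qed.

Lemma lipfree_submod_closed : submod_closed lipfree_pred.
Proof.
split.
  apply/asboolP/subset_closure; exists 0%N, (fun=> 0), (fun=> 0).
  by rewrite big_ord0.
move=> a mu nu /asboolP cmu /asboolP cnu; apply/asboolP.
have cont : continuous (fun p : lip0_dual * lip0_dual => a *: p.1 + p.2).
  move=> p; apply: cvgD; last exact: cvg_snd.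
  by apply: cvgZl_tmp; exact: cvg_fst.
move=> B /(cont (mu, nu))[[U V] /= [Umu Vnu] UV].
have [u [Su Uu]] := cmu _ Umu; have [v [Sv Vv]] := cnu _ Vnu.
by exists (a *: u + v); split; [exact: lip_eval_span_closed|exact: (UV (u, v))].
Qed.

HB.instance Definition _ :=
  GRing.isSubmodClosed.Build _ _ lipfree_pred lipfree_submod_closed.
HB.instance Definition _ := [SubChoice_isSubLmodule of lipfree by <:].

Definition lipfree_norm (mu : lipfree) : K := `|lipfree_val mu|.

Lemma lipfree_normD mu nu : lipfree_norm (mu + nu) <= lipfree_norm mu + lipfree_norm nu.
Proof. exact: ler_normD. Qed.

Lemma lipfree_normZ (l : K) mu : lipfree_norm (l *: mu) = `|l| * lipfree_norm mu.
Proof. exact: normrZ. Qed.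

Lemma lipfree_norm0_eq0 mu : lipfree_norm mu = 0 -> mu = 0.
Proof. by move=> /normr0_eq0 mu0; exact: val_inj. Qed.

HB.instance Definition _ :=
  Lmodule_isNormed.Build K lipfree lipfree_normD lipfree_normZ lipfree_norm0_eq0.

Lemma delta_subproof (x : X) : lip_eval x \in lipfree_pred.
Proof.
apply/asboolP/subset_closure; exists 1%N, (fun=> 1), (fun=> x).
by rewrite big_ord1 scale1r.
Qed.

Definition lip_delta (x : X) : lipfree := Lipfree (delta_subproof x).

End lipfree_space.

Section linearization.
Context {R : realType} {k : scalar_kind}.
Local Notation K := (scalars R k).

(* A bounded linear operator on [lipfree X] is determined by its values on the
   [lip_delta x], so the set below has at most one element. It is nonempty when [Y]
   is complete; the default [0] of [xget] is then irrelevant. *)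
Definition linearization (X : normedModType K) (Y : completeNormedModType K)
    (F : lip0 X Y) : blin (lipfree X) Y :=
  xget 0 [set T : blin (lipfree X) Y | forall x, T (lip_delta x) = F x].

End linearization.

(* Main.v *)
(* Let T be a rank-one operator on F(X), so that T(delta_x) = f(x) y, and let B be
   the supremum of the norms of Ghat + w T. The function
     q(a) = sup of |f(z + t a) - f(z)| / |t| over z in X and scalars t <> 0
   is a seminorm on X dominating |f(u) - f(v)| at u - v. Applying Ghat + w T to the
   molecule (delta_{z + t a} - delta_z) / t gives |G a + w c y| <= B |a| for every
   difference quotient c of f along a, hence |G a + d y| <= B |a| for all |d| <= q(a)
   by convexity. By Hahn-Banach there is a linear phi with |phi| <= q and
   |phi(x0)| = q(x0), so all G + w (phi (x) y) have norm at most B, and the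
   alternative Daugavet property of G yields 1 + |phi| |y| <= B. Therefore
   q(x0) |y| <= (B - 1) |x0| for all x0, which bounds the Lipschitz constant of
   x |-> T(delta_x), that is |T|, by B - 1.

   Hahn-Banach is proved by choosing a minimal sublinear function, which is linear. *)
From HB Require Import structures.
Require Import Defs.
From mathcomp Require Import all_boot all_order all_algebra.
From mathcomp Require Import all_classical all_reals all_analysis.
From mathcomp Require Import complex ring lra.

Set Implicit Arguments.
Unset Strict Implicit.
Unset Printing Implicit Defensive.

Import Order.TTheory GRing.Theory Num.Theory.
Import numFieldNormedType.Exports.

Local Open Scope classical_set_scope.
Local Open Scope ring_scope.

(** * The Hahn-Banach theorem for seminorms *)

Section sublinear.
Context {R : realType} {K : numFieldType} (i : {rmorphism R -> K}) (V : lmodType K).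
Implicit Types (p m : V -> R).

(** Through the embedding [i] of the reals, a complex space is treated as a real one. An inequality
    suffices for homogeneity: applied to [r^-1] it gives the reverse one. *)
Definition sublinear p :=
  (forall x y, p (x + y) <= p x + p y) /\
  (forall r x, 0 < r -> p (i r *: x) <= r * p x).

Lemma sublinear0 p : sublinear p -> p 0 = 0.
Proof.
move=> [_ pZ].
have := pZ 2 0 (ltr0Sn _ 1); have := pZ 2^-1 0; rewrite invr_gt0 ltr0Sn !scaler0.
by move=> /(_ isT) ? ?; lra.
Qed.

Lemma sublinearZ p r x : sublinear p -> 0 <= r -> p (i r *: x) = r * p x.
Proof.
move=> sp; rewrite le_eqVlt => /predU1P[<-|r0].
  by rewrite rmorph0 scale0r mul0r sublinear0.
have [_ pZ] := sp; apply/eqP; rewrite eq_le pZ//= -ler_pdivlMl//.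
have := pZ r^-1 (i r *: x); rewrite scalerA -rmorphM mulVf ?gt_eqF// rmorph1 scale1r.
by apply; rewrite invr_gt0.
Qed.

Lemma sublinear_geN p x : sublinear p -> - p (- x) <= p x.
Proof.
move=> sp; have [pD _] := sp.
by have := pD x (- x); rewrite subrr sublinear0//; lra.
Qed.

(** Serves both the tilts and the infima of chains. The lower bound [l] keeps the infima finite, and
    the index [h] may depend on those it combines. *)
Lemma sublinear_inf (I : Type) (S : set I) (f : I -> V -> R) (l : V -> R) :
  S !=set0 -> (forall x j, S j -> l x <= f j x) ->
  (forall x y j k, S j -> S k -> exists2 h, S h & f h (x + y) <= f j x + f k y) ->
  (forall r x j, 0 < r -> S j -> exists2 h, S h & f h (i r *: x) <= r * f j x) ->
  sublinear (fun x => inf [set f j x | j in S]).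
Proof.
move=> [j0 Sj0] fl fD fZ.
have hl x : has_lbound [set f j x | j in S] by exists (l x) => _ [j Sj <-]; exact: fl.
have h0 x : [set f j x | j in S] !=set0 by exists (f j0 x), j0.
split=> [x y|r x r0].
  rewrite -lerBlDr; apply: lb_le_inf => // _ [j Sj <-]; rewrite lerBlDr.
  rewrite -lerBlDl; apply: lb_le_inf => // _ [k Sk <-]; rewrite lerBlDl.
  have [h Sh hle] := fD x y j k Sj Sk.
  by apply: le_trans hle; apply: ge_inf => //; exists h.
rewrite -ler_pdivrMl//; apply: lb_le_inf => // _ [j Sj <-]; rewrite ler_pdivrMl//.
have [h Sh hle] := fZ r x j r0 Sj.
by apply: le_trans hle; apply: ge_inf => //; exists h.
Qed.

(* [tilt p y] is the largest sublinear function below [p] whose value at [- y] is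
   at most [- p y]; a minimal sublinear function equals all its tilts. *)
Definition tilt p y x : R := inf [set p (x + i t *: y) - t * p y | t in [set t | 0 <= t]].

(** Subadditivity, with [i t *: y] written as the sum of [- x] and [x + i t *: y]. *)
Lemma tilt_lb p y x t : sublinear p -> 0 <= t -> - p (- x) <= p (x + i t *: y) - t * p y.
Proof.
move=> sp t0; have [pD _] := sp; rewrite -(sublinearZ _ sp t0).
by have := pD (- x) (x + i t *: y); rewrite addKr; lra.
Qed.

Lemma sublinear_tilt p y : sublinear p -> sublinear (tilt p y).
Proof.
move=> sp; have [pD _] := sp.
apply: (@sublinear_inf _ _ _ (fun x => - p (- x))); first by exists 0 => /=.
- by move=> x t t0; exact: tilt_lb.
- move=> u v s t /= s0 t0; exists (s + t) => /=; first exact: addr_ge0.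
  rewrite mulrDl rmorphD scalerDl addrACA.
  by have := pD (u + i s *: y) (v + i t *: y); lra.
- move=> r x t r0 /= t0; exists (r * t); first by rewrite /= mulr_ge0// ltW.
  by rewrite rmorphM -scalerA -scalerDr sublinearZ ?(ltW r0)// mulrBr mulrA.
Qed.

Lemma tilt_le p y x t : sublinear p -> 0 <= t -> tilt p y x <= p (x + i t *: y) - t * p y.
Proof.
move=> sp t0; apply: ge_inf; last by exists t.
by exists (- p (- x)) => _ [s s0 <-]; exact: tilt_lb.
Qed.

Lemma tilt_le_id p y x : sublinear p -> tilt p y x <= p x.
Proof.
by move=> sp; have := tilt_le y x sp (lexx 0); rewrite rmorph0 scale0r addr0 mul0r subr0.
Qed.

Lemma minimal_sublinear p : sublinear p ->
  exists m, [/\ sublinear m, forall x, m x <= p x &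
    forall n, sublinear n -> (forall x, n x <= m x) -> n = m].
Proof.
move=> sp; pose T := {m | sublinear m /\ forall x, m x <= p x}.
(* The order is reversed, so that a maximal element for Zorn's lemma is a minimal function. *)
pose r (m n : T) := `[< forall x, sval n x <= sval m x >].
have rP (m n : T) : reflect (forall x, sval n x <= sval m x) (r m n) by exact: asboolP.
have [||||[m [sm mp]] mmin] := @Zorn T r.
- by move=> m; apply/rP.
- move=> a b c /rP ab /rP bc; apply/rP => x; exact: le_trans (bc x) (ab x).
- move=> [a pa] [b pb] /rP ab /rP ba; apply: eq_exist => /=.
  by apply/funext => x; apply/eqP; rewrite eq_le ab ba.
- move=> A tA; have [A0|/set0P[a0 Aa0]] := eqVneq A set0.
    by exists (exist _ p (conj sp (fun x => lexx _))) => a; rewrite A0.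
  (* Every sublinear function below [p] lies above [lo], so the pointwise infimum of a chain is
     finite. *)
  pose lo x := - p (- x).
  have lo_le (a : T) x : lo x <= sval a x.
    case: a => a [sa ap] /=; apply: le_trans (sublinear_geN x sa).
    by rewrite lerN2.
  have sI : sublinear (fun x => inf [set sval a x | a in A]).
    apply: (@sublinear_inf _ _ _ lo); first by exists a0.
    - by move=> x a _; exact: lo_le.
    - move=> x y a b Aa Ab; have [/rP ab|/rP ba] := tA a b Aa Ab.
        exists b => //; have [[bD _] _] := svalP b.
        by rewrite (le_trans (bD _ _))// lerD2r; exact: ab.
      exists a => //; have [[aD _] _] := svalP a.
      by rewrite (le_trans (aD _ _))// lerD2l; exact: ba.
    - by move=> s x a s0 Aa; exists a => //; have [[_ aZ] _] := svalP a; exact: aZ.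
  have Ile a x : A a -> inf [set sval a x | a in A] <= sval a x.
    move=> Aa; apply: ge_inf; last by exists a.
    by exists (lo x) => _ [b _ <-]; exact: lo_le.
  have Ip x : inf [set sval a x | a in A] <= p x.
    by apply: le_trans (Ile a0 x Aa0) _; have [] := svalP a0.
  exists (exist (fun m => sublinear m /\ forall x, m x <= p x) _ (conj sI Ip)) => a Aa.
  by apply/rP => x; exact: Ile.
exists m; split=> // n sn nm.
have np x : n x <= p x by exact: le_trans (nm x) (mp x).
by apply: (congr1 sval (mmin (exist _ n (conj sn np)) _)); apply/rP.
Qed.

(** Take [m] minimal below [tilt p x0]. As [m] equals its own tilts, [m x + m y <= m (x + y)],
    whence additivity; as [tilt p x0] is at most [- p x0] at [- x0], [m] reaches [p] at [x0]. *)
Lemma sublinear_support p x0 : sublinear p -> exists m,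
  [/\ forall x y, m (x + y) = m x + m y, forall r x, m (i r *: x) = r * m x,
      forall x, m x <= p x & m x0 = p x0].
Proof.
move=> sp; have [m [sm mt mmin]] := minimal_sublinear (sublinear_tilt x0 sp).
have mD x y : m (x + y) = m x + m y.
  have tm : tilt m y = m.
    by apply: mmin (sublinear_tilt y sm) _ => z; exact: tilt_le_id.
  have [mD _] := sm; apply/eqP; rewrite eq_le mD/=.
  have := tilt_le y x sm ler01; rewrite tm rmorph1 scale1r mul1r; lra.
have mN x : m (- x) = - m x.
  by apply/eqP; rewrite -addr_eq0 -mD addNr sublinear0.
have mp x : m x <= p x by exact: le_trans (mt x) (tilt_le_id _ _ sp).
exists m; split=> //.
  move=> r x; have [r0|/ltW r0] := leP 0 r; first exact: sublinearZ.
  rewrite -[r in LHS]opprK rmorphN scaleNr mN sublinearZ ?oppr_ge0//.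
  by rewrite mulNr opprK.
apply/eqP; rewrite eq_le mp/= -lerN2 -mN.
have := tilt_le x0 (- x0) sp ler01.
rewrite rmorph1 scale1r addNr sublinear0// mul1r sub0r; exact: le_trans (mt _).
Qed.

End sublinear.

(** * Supporting functionals of real and complex seminorms *)

Definition seminorm (K : numFieldType) (V : lmodType K) (q : V -> K) :=
  (forall x y, q (x + y) <= q x + q y) /\ (forall a x, q (a *: x) = `|a| * q x).

Lemma seminorm_ge0 (K : numFieldType) (V : lmodType K) (q : V -> K) x :
  seminorm q -> 0 <= q x.
Proof.
move=> [qD qZ]; have q0 : q 0 = 0 by rewrite -(scale0r 0) qZ normr0 mul0r.
have := qD x (-1 *: x).
by rewrite qZ normrN1 mul1r scaleN1r subrr q0 -mulr2n pmulrn_lge0.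
Qed.

Lemma real_seminorm_support (R : realType) (V : lmodType R) (q : V -> R) x0 :
  seminorm q -> exists f : V -> R^o,
  [/\ linear f, forall x, `|f x| <= q x & `|f x0| = q x0].
Proof.
move=> sq; have [qD qZ] := sq.
have [|m [mD mZ mq mx0]] := @sublinear_support R R idfun V q x0.
  by split=> // r x r0; rewrite qZ gtr0_norm.
have mN x : m (- x) = - m x by rewrite -scaleN1r [LHS]mZ mulN1r.
exists m; split=> [a x y|x|]; first by rewrite mD [X in X + _]mZ.
  rewrite ler_norml mq andbT lerNl -mN (le_trans (mq _))//.
  by rewrite -scaleN1r qZ normrN1 mul1r.
by rewrite mx0 ger0_norm// seminorm_ge0.
Qed.

Lemma complex_seminorm_support (R : realType) (V : lmodType R[i]) (q : V -> R[i]) x0 :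
  seminorm q -> exists f : V -> R[i]^o,
  [/\ linear f, forall x, `|f x| <= q x & `|f x0| = q x0].
Proof.
move=> sq; have [qD qZ] := sq.
have qE x : q x = (complex.Re (q x))%:C%C.
  have := seminorm_ge0 x sq; case: (q x) => u v.
  by rewrite lecE /= => /andP[/eqP v0 _]; subst v.
have [|m [mD mZ mq mx0]] := @sublinear_support R R[i] (@real_complex R) V
    (fun x => complex.Re (q x)) x0.
  split=> [x y|r x r0].
    by have := qD x y; rewrite lecE => /andP[_]; rewrite raddfD.
  rewrite qZ ger0_norm ?lecR ?(ltW r0)// qE.
  by rewrite /= mul0r subr0.
(* The only complex-linear functional whose real part is [m]. *)
pose f x : R[i]^o := (m x)%:C%C - 'i%C * (m ('i%C *: x))%:C%C.
have fD x y : f (x + y) = f x + f y.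
  by rewrite /f scalerDr !mD !rmorphD /=; ring.
have mR (r : R) x : m (r%:C%C *: x) = r * m x by exact: mZ.
have fZ a x : f (a *: x) = a * f x.
  case: a => u v.
  have -> : (u +i* v)%C = u%:C%C + v%:C%C * 'i%C :> R[i] by rewrite mulrC [LHS]complexE.
  have ii : 'i%C * 'i%C = -1 :> R[i] by rewrite -expr2 complex.sqr_i.
  have m1 : m ((u%:C%C + v%:C%C * 'i%C) *: x) = u * m x + v * m ('i%C *: x).
    by rewrite scalerDl -scalerA mD !mR.
  have m2 : m ('i%C *: ((u%:C%C + v%:C%C * 'i%C) *: x)) = u * m ('i%C *: x) - v * m x.
    rewrite scalerA mulrDr mulrCA ii mulrN1 -rmorphN mulrC scalerDl -scalerA mD !mR.
    by rewrite mulNr.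
  rewrite /f m1 m2 rmorphD rmorphB !rmorphM /=.
  by ring: ii.
(* Rotating [x] by a unit scalar makes the value of [f] real and nonnegative, hence equal to that of
   [m], which [q] dominates. *)
have fq x : `|f x| <= q x.
  have [->|fx0] := eqVneq (f x) 0; first by rewrite normr0 seminorm_ge0.
  pose w := `|f x| / f x.
  have w1 : `|w| = 1 by rewrite normf_div normr_id divff ?normr_eq0.
  have fw : f (w *: x) = `|f x| by rewrite fZ /w divfK.
  have -> : q x = q (w *: x) by rewrite qZ w1 mul1r.
  rewrite -fw [leRHS]qE.
  have [u v] : exists u, f (w *: x) = u%:C%C.
    by rewrite fw; case: (f x) => a b; rewrite normc_def; eexists.
  rewrite v lecR; suff -> : u = m (w *: x) by [].
  by have := congr1 (@complex.Re R) v; rewrite /f /= !mul0r mul1r subrr subr0.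
exists f; split=> // [a x y|]; first by rewrite fD fZ.
apply/eqP; rewrite eq_le fq /=.
have <- : (complex.Re (f x0))%:C%C = q x0.
  by rewrite /f /= !mul0r mul1r subrr subr0 mx0 -qE.
by apply: le_trans (normc_ge_Re _); rewrite lecR ler_norm.
Qed.

Lemma seminorm_support (R : realType) (k : scalar_kind) (V : lmodType (scalars R k))
    (q : V -> scalars R k) x0 :
  seminorm q -> exists f : V -> (scalars R k)^o,
  [/\ linear f, forall x, `|f x| <= q x & `|f x0| = q x0].
Proof.
by case: k V q x0 => V q x0; [exact: real_seminorm_support|exact: complex_seminorm_support].
Qed.

(** * Operators on the Lipschitz-free space *)

Section operators.
Context {R : realType} {k : scalar_kind}.
Local Notation K := (scalars R k).
Implicit Types E F X : normedModType K.

Lemma blin_normr_le E F (f : blin E F) x : `|f x| <= `|f| * `|x|.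
Proof. exact: blin_norm_ub. Qed.

Lemma blin_of_bounded E F (f : E -> F) (M : K) :
  linear f -> (forall x, `|f x| <= M * `|x|) -> exists g : blin E F, g =1 f.
Proof.
move=> lf fM; pose g : {linear E -> F} := HB.pack f (GRing.isLinear.Build _ _ _ _ f lf).
by exists (Blin (@blin_of_subproof _ _ _ _ g M fM)).
Qed.

Lemma bounded_seminorm_support E (q : E -> K) (M : K) x0 :
  seminorm q -> (forall x, q x <= M * `|x|) -> exists f : blin E K^o,
  (forall x, `|f x| <= q x) /\ `|f x0| = q x0.
Proof.
move=> sq qM; have [f [lf fq fx0]] := seminorm_support x0 sq.
have [g gf] := blin_of_bounded lf (fun x => le_trans (fq x) (qM x)).
by exists g; split=> [x|]; rewrite gf.
Qed.

Lemma norming_functional E (y : E) :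
  exists f : blin E K^o, (forall x, `|f x| <= `|x|) /\ `|f y| = `|y|.
Proof.
apply: (@bounded_seminorm_support _ _ 1) => [|x]; last by rewrite mul1r.
by split; [exact: ler_normD|exact: normrZ].
Qed.

Lemma blinB E F (f : blin E F) x y : f (x - y) = f x - f y.
Proof. exact: linearB. Qed.

Lemma blin_subE E F (f g : blin E F) x : (f - g) x = f x - g x.
Proof. by []. Qed.

Lemma sum_blinE E F n (T : 'I_n -> blin E F) x :
  (\sum_(i < n) T i) x = \sum_(i < n) T i x.
Proof. by elim/big_rec2: _ => // i s t _ <-. Qed.

Lemma lip_delta_lipschitz X (x y : X) : `|lip_delta x - lip_delta y| <= `|x - y|.
Proof.
apply: (@blin_norm_le _ _ _ _ (lip_eval x - lip_eval y)) => // f.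
by rewrite mulrC; exact: lip0_norm_ub.
Qed.

Lemma lip_delta0 X : lip_delta (0 : X) = 0.
Proof. by apply/val_inj/val_inj/funext => f; exact: lip0_at0. Qed.

Lemma lip0_of_operator X F (T : blin (lipfree X) F) : exists f : lip0 X F,
  f =1 T \o @lip_delta _ _ X.
Proof.
have Tl : T \o @lip_delta _ _ X \in @lip0_pred R k X F.
  apply/asboolP; split; first by rewrite /= lip_delta0 linear0.
  apply/lipschitzP; exists `|T| => x y /=; rewrite -blinB.
  by apply: le_trans (blin_normr_le _ _) _; rewrite ler_wpM2l// lip_delta_lipschitz.
by exists (Lip0 Tl).
Qed.

(** Both sides agree on finite combinations of the [lip_delta x], which are dense, and both are
    continuous in [mu]. *)
Lemma lipfree_functionalE X (psi : blin (lipfree X) K^o) (f : lip0 X K^o) mu :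
  (forall x, psi (lip_delta x) = f x) -> psi mu = lipfree_val mu f.
Proof.
move=> psif; apply/subr0_eq/eqP; rewrite -normr_le0; apply/ler_addgt0Pr => e e0.
(* With this [d] the two error terms add up to at most [e]; the summand 1 keeps the denominator
   positive. *)
rewrite add0r; pose d := e / (`|psi| + `|f| + 1).
have M0 : 0 < `|psi| + `|f| + 1 by rewrite ltr_wpDl// addr_ge0.
have d0 : 0 < d by rewrite divr_gt0.
have /asboolP clmu := valP mu.
have [_ [[n [a [x ->]]]]] := clmu _ (nbhsx_ballx _ _ d0).
rewrite -ball_normE/=; set nu := \sum_(i < n) _ => mud.
pose nu' := \sum_(i < n) a i *: lip_delta (x i).
have nuE : lipfree_val nu' = nu.
  by rewrite [LHS](raddf_sum \val); apply: eq_bigr => i _.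
have psinu : psi nu' = nu f.
  rewrite linear_sum sum_blinE; apply: eq_bigr => i _.
  by rewrite linearZ /= psif.
have -> : psi mu - lipfree_val mu f = psi (mu - nu') - (lipfree_val mu - nu) f.
  by rewrite blinB psinu blin_subE opprB addrA subrK.
apply: le_trans (ler_normB _ _) _.
have h1 : `|psi (mu - nu')| <= `|psi| * d.
  apply: le_trans (blin_normr_le _ _) _; rewrite ler_wpM2l// ltW//.
  by rewrite [ltLHS](_ : _ = `|lipfree_val mu - nu|)// -nuE.
have h2 : `|(lipfree_val mu - nu) f| <= `|f| * d.
  by apply: le_trans (blin_normr_le _ _) _; rewrite mulrC ler_wpM2l// ltW.
apply: le_trans (lerD h1 h2) _; rewrite -mulrDl /d mulrCA ler_piMr ?(ltW e0)//.
by rewrite ler_pdivrMr// mul1r lerDl.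
Qed.

(** A norming functional [phi] of [T mu] reduces [T] to the scalar function [phi \o T \o lip_delta],
    which is [M]-Lipschitz and at which [mu] takes the value [phi (T mu)]. *)
Lemma lipfree_operator_le X F (T : blin (lipfree X) F) (M : K) : 0 <= M ->
  (forall x y, `|T (lip_delta x) - T (lip_delta y)| <= M * `|x - y|) ->
  `|T| <= M.
Proof.
move=> M0 TM; apply: blin_norm_le => // mu.
have [phi [phi1 <-]] := norming_functional (T mu).
have [||psi psiE] := @blin_of_bounded _ _ (phi \o T : _ -> K^o) `|T|.
- by move=> a x y /=; rewrite !linearP.
- by move=> x; apply: le_trans (phi1 _) _; exact: blin_normr_le.
have [f fpsi] := lip0_of_operator psi.
rewrite -[phi _]psiE (@lipfree_functionalE _ psi f); last by move=> x; rewrite fpsi.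
apply: le_trans (blin_normr_le _ _) _; rewrite mulrC ler_wpM2r//.
apply: lip0_norm_le => // x y; rewrite !fpsi /= !psiE /= -!blinB.
by apply: le_trans (phi1 _) _; rewrite blinB.
Qed.

End operators.

(** * Existence of the linearization of a bounded operator *)

Section linearization_of_operators.
Context {R : realType} {k : scalar_kind}.
Local Notation K := (scalars R k).
Variables (X : normedModType K) (Y : completeNormedModType K) (G : blin X Y).

(* [y] is the value at [mu] of the linearization of [G], tested on the dual of [Y]. *)
Definition linearizes (mu : lip0_dual X) (y : Y) :=
  forall (phi : blin Y K^o) (f : lip0 X K^o), f =1 phi \o G -> phi y = mu f.

Lemma linearizes_delta x : linearizes (lip_eval x) (G x).
Proof. by move=> phi f fE; rewrite /= fE. Qed.

Lemma linearizesP a mu nu y z : linearizes mu y -> linearizes nu z ->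
  linearizes (a *: mu + nu) (a *: y + z).
Proof.
by move=> muy nuz phi f fE; rewrite blin_is_linear (muy _ _ fE) (nuz _ _ fE).
Qed.

Lemma lip0_comp (phi : blin Y K^o) : exists f : lip0 X K^o, f =1 phi \o G.
Proof.
have fG : phi \o G \in @lip0_pred R k X K^o.
  apply/asboolP; split; first by rewrite /= !linear0.
  apply/lipschitzP; exists (`|phi| * `|G|) => x y /=; rewrite -!blinB.
  apply: le_trans (blin_normr_le _ _) _.
  by rewrite -mulrA ler_wpM2l// blin_normr_le.
by exists (Lip0 fG).
Qed.

(** A norming functional of [y], composed with [G], has Lipschitz norm at most that of [G]. Applied
    to differences, the bound gives uniqueness and continuity of the value. *)
Lemma linearizes_le mu y : linearizes mu y -> `|y| <= `|mu| * `|G|.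
Proof.
move=> muy; have [phi [phi1 <-]] := norming_functional y.
have [f fE] := lip0_comp phi; rewrite (muy _ _ fE).
apply: le_trans (blin_normr_le _ _) _; rewrite ler_wpM2l//.
apply: lip0_norm_le => // u v; rewrite !fE /= -!blinB.
by apply: le_trans (phi1 _) _; exact: blin_normr_le.
Qed.

Lemma linearizes_dist mu nu y z : linearizes mu y -> linearizes nu z ->
  `|y - z| <= `|mu - nu| * `|G|.
Proof.
move=> muy nuz; apply: linearizes_le; rewrite addrC -scaleN1r.
rewrite [y - z]addrC -(scaleN1r z); exact: linearizesP.
Qed.

(** The values at functionals tending to [mu] form a Cauchy filter. Completeness of [Y] provides its
    limit, and the defining identity passes to the limit. *)
Lemma linearizes_closure mu :
  closure [set nu | exists y, linearizes nu y] mu -> exists y, linearizes mu y.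
Proof.
move=> clmu; pose F : set_system Y :=
  [set B | nbhs mu [set nu | forall y, linearizes nu y -> B y]].
have FF : ProperFilter F.
  split; first by move=> /clmu[nu [[y nuy]]] /(_ y nuy).
  split; first by apply: (@filterE _ (nbhs mu)).
  - move=> A B FA FB; rewrite /F /=.
    apply: filterS (@filterI _ (nbhs mu) _ _ _ FA FB) => nu [nuA nuB] y nuy.
    by split; [exact: nuA|exact: nuB].
  - move=> A B AB FA; rewrite /F /=.
    by apply: (@filterS _ (nbhs mu) _ _ _ _ FA) => nu nuA y /nuA/AB.
have /cauchy_cvgP/cvg_ex[/= y Fy] : cauchy F.
  (* Two functionals within [d] of [mu] are at most [d + d] apart, hence the two copies of the norm
     of [G]. *)
  apply: cauchy_exP => e e0; pose d := e / (`|G| + `|G| + 1).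
  have M0 : 0 < `|G| + `|G| + 1 by rewrite ltr_wpDl// addr_ge0.
  have d0 : 0 < d by rewrite divr_gt0.
  have [nu [[z nuz] nud]] := clmu _ (nbhsx_ballx _ _ d0).
  exists z; apply: filterS (nbhsx_ballx _ _ d0) => nu' nud' z' nuz'.
  rewrite -ball_normE /=; apply: le_lt_trans (linearizes_dist nuz nuz') _.
  move: nud nud'; rewrite -!ball_normE /= => nud nud'.
  have dd : `|nu - nu'| <= d + d.
    apply: le_trans (ler_distD mu _ _) _; rewrite lerD// ltW//.
    by rewrite distrC.
  apply: le_lt_trans (ler_wpM2r _ dd) _ => //.
  rewrite /d -mulrDl mulrAC ltr_pdivrMr// mulrDl -mulrDr ltr_pM2l//.
  by rewrite ltrDl.
exists y => phi f fE; apply/subr0_eq/eqP; rewrite -normr_le0.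
apply/ler_addgt0Pr => e e0; rewrite add0r.
have M0 : 0 < `|phi| + `|f| + 1 by rewrite ltr_wpDl// addr_ge0.
pose d := e / (`|phi| + `|f| + 1); have d0 : 0 < d by rewrite divr_gt0.
have FB : F (ball y d) by apply: Fy; exact: nbhsx_ballx.
have [nu [[z nuz] [/(_ z nuz) yz mud]]] :=
  clmu _ (@filterI _ (nbhs mu) _ _ _ FB (nbhsx_ballx _ _ d0)).
move: yz mud; rewrite -!ball_normE /= => yz mud.
have -> : phi y - mu f = phi (y - z) - (mu - nu) f.
  by rewrite blinB blin_subE (nuz _ _ fE) opprB addrA subrK.
apply: le_trans (ler_normB _ _) _.
have h1 : `|phi (y - z)| <= `|phi| * d.
  by apply: le_trans (blin_normr_le _ _) _; rewrite ler_wpM2l// ltW.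
have h2 : `|(mu - nu) f| <= `|f| * d.
  by apply: le_trans (blin_normr_le _ _) _; rewrite mulrC ler_wpM2l// ltW.
apply: le_trans (lerD h1 h2) _; rewrite -mulrDl /d mulrCA ler_piMr ?(ltW e0)//.
by rewrite ler_pdivrMr// mul1r lerDl.
Qed.

Lemma linearization_delta x : linearization (lip0_of_blin G) (lip_delta x) = G x.
Proof.
suff [T TG] : exists T : blin (lipfree X) Y, forall x, T (lip_delta x) = G x.
  (* Once some operator has the prescribed values, [xget] returns such an operator and not its
     default. *)
  by rewrite /linearization; case: xgetP => [? _ -> //|/(_ T)[]].
have lin (mu : lipfree X) : exists y, linearizes (lipfree_val mu) y.
  apply: linearizes_closure; have /asboolP := valP mu.
  apply: closure_subset => _ [n [a [z ->]]].
  elim/big_rec: _ => [|i nu _ [y nuy]].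
    exists 0 => phi f _; exact: linear0.
  by exists (a i *: G (z i) + y); apply: linearizesP nuy; exact: linearizes_delta.
have {lin}[T linT] := choice lin.
(* Uniqueness makes the pointwise chosen values linear in [mu]. *)
have uniq mu y z : linearizes mu y -> linearizes mu z -> y = z.
  move=> muy muz; apply/subr0_eq/eqP; rewrite -normr_le0.
  by apply: le_trans (linearizes_dist muy muz) _; rewrite subrr normr0 mul0r.
have [||T' T'E] := @blin_of_bounded _ _ _ _ T `|G|.
- move=> a mu nu; apply: uniq (linT _) _.
  exact: (linearizesP a (linT mu) (linT nu)).
- by move=> mu; rewrite mulrC; exact: linearizes_le (linT mu).
by exists T' => z; rewrite T'E; apply: uniq (linT _) _; exact: linearizes_delta.
Qed.

End linearization_of_operators.

(** * Increments of a Lipschitz function *)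

Section increments.
Context {R : realType} {k : scalar_kind}.
Local Notation K := (scalars R k).
Variables (X : normedModType K) (f : X -> K^o) (L : K).
Hypotheses (L0 : 0 <= L) (fL : forall x y, `|f x - f y| <= L * `|x - y|).

Definition increment (x z : X) (t : K) : K := (f (z + t *: x) - f z) / t.

(* The supremum over all steps [t], and not only [t = 1], makes this a seminorm. *)
Definition max_increment (x : X) : K :=
  ksup [set `|increment x p.1 p.2| | p in [set p : X * K | p.2 != 0]].

Let nneg x r :
  [set `|increment x p.1 p.2| | p in [set p : X * K | p.2 != 0]] r -> 0 <= r.
Proof. by case=> p _ <-. Qed.

Let bnd x : ubound [set `|increment x p.1 p.2| | p in [set p : X * K | p.2 != 0]]
  (L * `|x|).
Proof.
move=> _ [[z t] /= t0 <-]; rewrite normf_div ler_pdivrMr ?normr_gt0//.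
by apply: le_trans (fL _ _) _; rewrite addrC addKr normrZ [`|t| * _]mulrC mulrA.
Qed.

Lemma le_max_increment x z t : t != 0 -> `|increment x z t| <= max_increment x.
Proof. by move=> t0; apply: ksup_ubound (@nneg x) (@bnd x) _; exists (z, t). Qed.

Lemma max_increment_le x M : 0 <= M ->
  (forall z t, t != 0 -> `|increment x z t| <= M) -> max_increment x <= M.
Proof.
by move=> M0 h; apply: ksup_le (@nneg x) M0 _ => _ [[z t] /= t0 <-]; exact: h.
Qed.

Lemma max_increment_ge0 x : 0 <= max_increment x.
Proof. exact: ksup_ge0 (@nneg x) (@bnd x). Qed.

Lemma max_increment_lip x : max_increment x <= L * `|x|.
Proof.
apply: max_increment_le => [|z t t0]; first by rewrite mulr_ge0.
by apply: bnd; exists (z, t).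
Qed.

Lemma dist_le_max_increment x y : `|f x - f y| <= max_increment (x - y).
Proof.
have := le_max_increment (x - y) y (oner_neq0 _).
by rewrite /increment scale1r divr1 [y + _]addrC subrK.
Qed.

Let max_incrementZ_le a x : max_increment (a *: x) <= `|a| * max_increment x.
Proof.
apply: max_increment_le => [|z t t0]; first by rewrite mulr_ge0 ?max_increment_ge0.
have [->|a0] := eqVneq a 0.
  by rewrite /increment scale0r scaler0 addr0 subrr mul0r !normr0 mul0r.
(* A step [t] along [a *: x] is a step [t * a] along [x]. *)
have -> : increment (a *: x) z t = a * increment x z (t * a).
  by rewrite /increment scalerA mulrCA invfM [a * _]mulrCA mulfV// mulr1.
by rewrite normrM ler_wpM2l// le_max_increment// mulf_neq0.
Qed.

Lemma max_increment_seminorm : seminorm max_increment.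
Proof.
split=> [x y|a x].
  apply: max_increment_le => [|z t t0]; first by rewrite addr_ge0 ?max_increment_ge0.
  (* The increment is split at the intermediate point [z + t *: y]. *)
  have -> : increment (x + y) z t = increment x (z + t *: y) t + increment y z t.
    by rewrite /increment -mulrDl addrA subrK scalerDr [_ *: x + _]addrC addrA.
  by apply: le_trans (ler_normD _ _) _; rewrite lerD// le_max_increment.
have [->|a0] := eqVneq a 0.
  apply/eqP; rewrite eq_le max_incrementZ_le normr0 mul0r max_increment_ge0.
  by [].
apply/eqP; rewrite eq_le max_incrementZ_le/= -ler_pdivlMl ?normr_gt0// -normfV.
by have := max_incrementZ_le a^-1 (a *: x); rewrite scalerA mulVf// scale1r.
Qed.

(** Otherwise the norm of [d] would bound all quotients, hence their supremum. The strict inequality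
    allows for a supremum that is not attained. *)
Lemma max_increment_exceeds x (d : K) : `|d| < max_increment x ->
  exists z t, t != 0 /\ `|d| <= `|increment x z t|.
Proof.
move=> dx; apply: contrapT => /forallNP h.
have : max_increment x <= `|d|.
  apply: max_increment_le => // z t t0; apply/ltW; rewrite real_ltNge//.
  by apply/negP => dt; apply: (h z); exists t.
by move=> /le_lt_trans/(_ dx); rewrite ltxx.
Qed.

End increments.

(* The largest value of [`|u + w *: v|] over [`|w| = r] is convex and even in [r]. *)
Lemma norm_rotations_le (K : numFieldType) (V : normedModType K) (u v : V) (c d M : K) :
  (forall w, `|w| = 1 -> `|u + (w * c) *: v| <= M) -> `|d| <= `|c| ->
  `|u + d *: v| <= M.
Proof.
move=> uM dc; have [c0|c0] := eqVneq c 0.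
  have := uM 1 (normr1 _); move: dc; rewrite c0 normr0 normr_le0 => /eqP ->.
  by rewrite mulr0.
pose e := d / c; have e1 : `|e| <= 1.
  by rewrite normf_div ler_pdivrMr ?normr_gt0// mul1r.
have [w w1 ew] : exists2 w, `|w| = 1 & e = `|e| * w.
  have [->|e0] := eqVneq e 0; first by exists 1; rewrite ?normr1// normr0 mul0r.
  exists (e / `|e|); last by rewrite mulrC divfK// normr_eq0.
  by rewrite normf_div normr_id divff// normr_eq0.
(* Weights with sum 1 and difference the norm of [e], so that [d] is the convex combination of
   [w * c] and [- w * c] with weights [s] and [t]. *)
pose s := (1 + `|e|) / 2; pose t := (1 - `|e|) / 2.
have s0 : 0 <= s by rewrite divr_ge0// addr_ge0.
have t0 : 0 <= t by rewrite divr_ge0// subr_ge0.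
have st : s + t = 1 by rewrite /s /t; field.
have -> : u + d *: v = s *: (u + (w * c) *: v) + t *: (u + (- w * c) *: v).
  rewrite !scalerDr addrACA -scalerDl st scale1r !scalerA -scalerDl; congr (_ + _ *: _).
  by rewrite -[d](divfK c0) -/e ew /s /t; field.
clearbody s t; rewrite -[M]mul1r -st mulrDl (le_trans (ler_normD _ _))//.
by rewrite !normrZ (ger0_norm s0) (ger0_norm t0) lerD// ler_wpM2l// uM// normrN.
Qed.

(** * The alternative Daugavet property of the linearization *)

Theorem theorem7p10 (R : realType) (k : scalar_kind)
    (X Y : completeNormedModType (scalars R k)) (G : blin X Y) :
  `|G| = 1 -> alternative_daugavet G ->
  alternative_daugavet (linearization (lip0_of_blin G)).
Proof.
move=> G1 GaD T [y y0 Ty].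
set S := linearization _.
have SE x : S (lip_delta x) = G x by exact: linearization_delta.
(* By the triangle inequality this gives the upper half, [B <= 1 + |T|]. *)
have S1 : `|S| <= 1.
  apply: lipfree_operator_le => // u v; rewrite !SE -blinB.
  by rewrite -G1 blin_normr_le.
have ny0 : 0 < `|y| by rewrite normr_gt0.
have /choice[f fE] : forall x, exists c : scalars R k, T (lip_delta x) = c *: y.
  move=> x; have : range T (T (lip_delta x)) by exists (lip_delta x).
  by rewrite Ty => -[c _ <-]; exists c.
have fT u v : `|f u - f v| * `|y| = `|T (lip_delta u) - T (lip_delta v)|.
  by rewrite !fE -scalerBl normrZ.
pose L := `|T| / `|y|; have L0 : 0 <= L by rewrite divr_ge0.
have fL u v : `|f u - f v| <= L * `|u - v|.
  rewrite /L mulrAC ler_pdivlMr// fT -blinB.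
  by apply: le_trans (blin_normr_le _ _) _; rewrite ler_wpM2l// lip_delta_lipschitz.
pose q := max_increment f; have sq : seminorm q := max_increment_seminorm fL.
set A := [set _ | _ in _]; pose B := ksup A.
have A0 r : A r -> 0 <= r by case=> w _ <-.
have AT : ubound A (1 + `|T|).
  move=> _ [w /= w1 <-]; apply: le_trans (ler_normD _ _) _.
  by rewrite normrZ w1 mul1r lerD2r.
have SB w : `|w| = 1 -> `|S + w *: T| <= B.
  by move=> w1; apply: ksup_ubound A0 AT _; exists w.
have GB1 a z t w : t != 0 -> `|w| = 1 ->
    `|G a + (w * increment f a z t) *: y| <= B * `|a|.
  move=> t0 w1; pose mu := t^-1 *: (lip_delta (z + t *: a) - lip_delta z).
  have muE : G a + (w * increment f a z t) *: y = (S + w *: T) mu.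
    have -> : (S + w *: T) mu = S mu + w *: T mu by [].
    rewrite /mu !linearZ /= !blinB !SE !fE -blinB [z + _]addrC addrK.
    rewrite -scalerBl linearZ /= scalerA mulVf// scale1r !scalerA.
    by congr (_ + _ *: _); rewrite /increment [z + _]addrC [LHS]mulrC -[LHS]mulrA [LHS]mulrC.
  rewrite muE; apply: le_trans (blin_normr_le _ _) _; apply: ler_pM => //.
    exact: SB.
  rewrite normrZ normfV ler_pdivrMl ?normr_gt0//.
  by apply: le_trans (lip_delta_lipschitz _ _) _; rewrite addrC addKr normrZ.
have GB2 a d : `|d| < q a -> `|G a + d *: y| <= B * `|a|.
  move=> /max_increment_exceeds[z [t [t0 dt]]].
  by apply: norm_rotations_le dt => w w1; exact: GB1.
have GB a d : `|d| <= q a -> `|G a + d *: y| <= B * `|a|.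
  (* Shrinking [d = 0] would not make the inequality strict; instead any quotient dominates 0, here
     the one at 0 with step 1. *)
  move=> dq; have [->|d0] := eqVneq d 0.
    apply: (@norm_rotations_le _ _ _ _ (increment f a 0 1)) => [w w1|]; rewrite ?normr0//.
    by rewrite GB1// oner_neq0.
  apply/ler_addgt0Pr => e e0; pose M := `|d| * `|y| + e.
  have M0 : 0 < M by rewrite ltr_wpDl// mulr_ge0.
  have nd0 : 0 < `|d| by rewrite normr_gt0.
  (* Shrinking [d] by [s < 1] makes the bound by [q a] strict; with this [s] the remainder
     [((1 - s) * d) *: y] has norm at most [e]. *)
  pose s := `|d| * `|y| / M.
  have s0 : 0 <= s by rewrite divr_ge0// ?mulr_ge0// ltW.
  have s1 : s < 1 by rewrite ltr_pdivrMr// mul1r ltrDl.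
  have sd : `|s * d| < q a.
    by apply: lt_le_trans dq; rewrite normrM ger0_norm// gtr_pMl.
  have -> : G a + d *: y = (G a + (s * d) *: y) + ((1 - s) * d) *: y.
    by rewrite -addrA -scalerDl -mulrDl [s + _]addrC subrK mul1r.
  apply: le_trans (ler_normD _ _) _; apply: lerD; first exact: GB2.
  rewrite normrZ normrM ger0_norm ?subr_ge0 ?(ltW s1)//.
  have -> : 1 - s = e / M.
    by rewrite -[1](divff (lt0r_neq0 M0)) -mulrBl /M addrAC subrr add0r.
  rewrite -mulrA mulrAC ler_pdivrMr// ler_wpM2l ?(ltW e0)//.
  by rewrite /M lerDl ltW.
(* Since [q x0] is nonzero, the supporting functional is nonzero and the operator [P] built from it
   has rank one. *)
have Bq x0 : q x0 != 0 -> 1 <= B /\ q x0 * `|y| <= (B - 1) * `|x0|.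
  move=> q0; have [phi [phiq phix0]] :=
    bounded_seminorm_support x0 sq (max_increment_lip L0 fL).
  have [||P PE] := @blin_of_bounded _ _ _ _ (fun x => phi x *: y) (`|phi| * `|y|).
  - by move=> a u v; rewrite linearP /= scalerDl scalerA.
  - by move=> x; rewrite normrZ mulrAC ler_wpM2r// blin_normr_le.
  have phi0 : phi x0 != 0 by rewrite -normr_eq0 phix0.
  have P1 : rank_one P.
    exists y => //; apply/seteqP; split=> [_ [x _ <-]|_ [c _ <-]].
      by exists (phi x); rewrite // PE.
    exists ((c / phi x0) *: x0) => //.
    have phic : phi ((c / phi x0) *: x0) = c by rewrite linearZ; exact: divfK.
    by rewrite PE phic.
  have PB : 1 + `|P| <= B.
    have B0 : 0 <= B by exact: ksup_ge0 A0 AT.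
    rewrite -(GaD P P1); apply: ksup_le => [_ [w _ <-]//||_ [w /= w1 <-]]//.
    apply: blin_norm_le => // a.
    have -> : (G + w *: P) a = G a + (w * phi a) *: y.
      by rewrite -scalerA -PE.
    by apply: GB; rewrite normrM w1 mul1r.
  split; first by apply: le_trans PB; rewrite lerDl.
  have -> : q x0 * `|y| = `|P x0| by rewrite PE normrZ phix0.
  apply: le_trans (blin_normr_le _ _) _; rewrite ler_wpM2r//.
  by rewrite lerBrDl.
(* If [q] vanished, [f] would be constant and [T] zero, against its rank. A point with nonzero [q]
   yields [1 <= B], so that [B - 1] can serve as a Lipschitz constant. *)
have [x0 qx0] : exists x0, q x0 != 0.
  apply: contrapT => /forallNP q0.
  have T0 : `|T| <= 0.
    apply: lipfree_operator_le => // u v; rewrite -fT mul0r.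
    have -> : f u - f v = 0; last by rewrite normr0 mul0r.
    apply/eqP; rewrite -normr_le0; apply: le_trans (dist_le_max_increment fL _ _) _.
    by rewrite le_eqVlt; apply/orP; left; apply: contrapT => /negP; exact: q0.
  have : range T y by rewrite Ty; exists 1; rewrite ?scale1r.
  case=> mu _ Tmu; case/eqP: y0.
  by rewrite -Tmu; move: T0; rewrite normr_le0 => /eqP ->.
have [B1 _] := Bq x0 qx0.
apply/eqP; rewrite eq_le; apply/andP; split.
  by apply: ksup_le => //; rewrite addr_ge0.
rewrite -/B -lerBrDl; apply: lipfree_operator_le; first by rewrite subr_ge0.
move=> u v; rewrite -fT; have := dist_le_max_increment fL u v.
(* Where [q] vanishes [Bq] does not apply, but then [f u = f v]. *)
have [q0|q0] := eqVneq (q (u - v)) 0.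
  rewrite -/q q0 normr_le0 => /eqP ->.
  by rewrite normr0 mul0r mulr_ge0// subr_ge0.
move=> fq; apply: le_trans (Bq _ q0).2.
by rewrite ler_wpM2r.
Qed.
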